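(* Let $G\le S_n$ be an intransitive group and let $\Pi$ be the partition of $[n]$ into the orbits of $G$. Let $a$ and $b$ be the largest positive integers $\alpha$ and $\beta$ (with $\alpha+\beta\le n$), respectively, such that $S^{\alpha,\beta}_n \le G$. Then for all integers $\ell\ge M_{a,b}(\Pi)$, we have $\mathrm{Comp}_{n+\ell}(G) = S^{a,b}_{n+\ell}$ or $\mathrm{Comp}_{n+\ell}(G) = \langle S^{a,b}_{n+\ell},\delta_{n+\ell}\rangle$.
   Context: $S_n$ is the symmetric group on $[n]=\{1,\dots,n\}$; $\delta_n$ is $i\mapsto n+1-i$. For positive integers $\alpha,\beta$ with $\alpha+\beta\le m$, $S^{\alpha,\beta}_m$ is the group of permutations of $[m]$ mapping each of $\{1,\dots,\alpha\}$ and $\{m-\beta+1,\dots,m\}$ onto itself and fixing every point of $\{\alpha+1,\dots,m-\beta\}$ ($S^{1,1}_m$ is trivial). For a partition $\Pi$ of $[n]$, $\widehat{\Pi}$ is the coarsest partition of $[n]$ into intervals refining $\Pi$, $[1]_{\widehat\Pi}$ and $[n]_{\widehat\Pi}$ its blocks containing $1$ and $n$, $M(\Pi)$ the maximum of $1$ and the sizes of the blocks of $\widehat\Pi$ other than these two, and $M_{a,b}(\Pi)=\max(M(\Pi),\ |[1]_{\widehat\Pi}|-a+1,\ |[n]_{\widehat\Pi}|-b+1)$. A permutation $\pi\in S_m$ involves $\tau\in S_n$ ($n\le m$) if there are indices $i_1<\dots<i_n$ with $\pi(i_j)<\pi(i_k)$ iff $\tau(j)<\tau(k)$ for all $j,k$;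 such $\tau$ is an $n$-pattern of $\pi$. For $S\subseteq S_n$, $\mathrm{Comp}_m(S)$ is the set of $\tau\in S_m$ all of whose $n$-patterns belong to $S$. *)

(* Defs.v *)
From mathcomp Require Import all_boot all_fingroup.

Set Implicit Arguments.
Unset Strict Implicit.
Unset Printing Implicit Defensive.

(* The point i of [n] = {1, ..., n} is the ordinal i - 1 of 'I_n. *)

Definition delta (m : nat) : 'S_m := perm (@rev_ord_inj m).

Definition low_points (m alpha : nat) : {set 'I_m} := [set i : 'I_m | i < alpha].

Definition high_points (m beta : nat) : {set 'I_m} :=
  [set i : 'I_m | m - beta <= i].

Definition Sab (m alpha beta : nat) : {set 'S_m} :=
  [set s : 'S_m |
    [&& s @: low_points m alpha == low_points m alpha,
        s @: high_points m beta == high_points m beta &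
        [forall i : 'I_m, (alpha <= i < m - beta) ==> (s i == i)]]].

Definition admissible n (G : {set 'S_n}) (alpha beta : nat) : Prop :=
  [/\ 0 < alpha, 0 < beta, alpha + beta <= n & Sab n alpha beta \subset G].

Definition is_largest (P : nat -> Prop) (x : nat) : Prop :=
  P x /\ forall y, P y -> y <= x.

Definition involves m n (p : 'S_m) (t : 'S_n) : bool :=
  [exists f : {ffun 'I_n -> 'I_m},
    [forall j : 'I_n, forall k : 'I_n,
      ((j < k) ==> (f j < f k)) && ((p (f j) < p (f k)) == (t j < t k))]].

Definition Comp m n (S : {set 'S_n}) : {set 'S_m} :=
  [set p : 'S_m | [forall t : 'S_n, involves p t ==> (t \in S)]].

Definition intransitive n (G : {set 'S_n}) : bool :=
  ~~ [transitive G, on [set: 'I_n] | 'P].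

Definition orbits_of n (G : {set 'S_n}) : {set {set 'I_n}} :=
  orbit 'P G @: [set: 'I_n].

Section IntervalPartitions.

Variable n : nat.
Implicit Types (P Q : {set {set 'I_n}}) (B : {set 'I_n}).

Definition is_interval B : bool :=
  [forall i in B, forall j in B, forall k : 'I_n, (i <= k <= j) ==> (k \in B)].

Definition interval_partition Q : bool :=
  partition Q [set: 'I_n] && [forall B in Q, is_interval B].

Definition refines Q P : bool := [forall B in Q, [exists C in P, B \subset C]].

Definition coarsest_interval_refinement P Q : bool :=
  [&& interval_partition Q, refines Q P &
      [forall Q' : {set {set 'I_n}},
         interval_partition Q' && refines Q' P ==> refines Q' Q]].

(* The default value is never used when P is a partition: see hatP. *)
Definition hat P : {set {set 'I_n}} :=
  odflt set0 [pick Q | coarsest_interval_refinement P Q].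

Lemma hatP P : partition P [set: 'I_n] -> coarsest_interval_refinement P (hat P).
Proof.
move=> partP; rewrite /hat; case: pickP => [//|/= noQ]; exfalso.
have [/eqP covP trivP _] := and3P partP.
have inP i : i \in cover P by rewrite covP inE.
pose between (i j k : 'I_n) := (i <= k <= j) || (j <= k <= i).
pose R (i j : 'I_n) :=
  [forall k : 'I_n, between i j k ==> (pblock P k == pblock P i)].
have RP i j : reflect (forall k : 'I_n, between i j k -> pblock P k = pblock P i)
                      (R i j).
  apply: (iffP forallP) => [h k hk | h k]; first exact/eqP/(implyP (h k)).
  by apply/implyP => /h ->.
have betl i j : between i j i by rewrite /between leqnn /= andbT leq_total.
have betr i j : between i j j by rewrite /between leqnn andbT leq_total.
have betC i j k : between i j k = between j i k by rewrite /between orbC.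
have betT i j k l : between i k l -> between i j l || between j k l.
  rewrite /between => /orP[]/andP[h1 h2]; case: (leqP l j) => [lj|/ltnW lj];
    by rewrite ?h1 ?lj ?h2 /= ?orbT.
have eqvR : {in [set: 'I_n] & &, equivalence_rel R}.
  have R_refl i : R i i.
    by apply/RP => k; rewrite /between orbb -eqn_leq => /eqP/val_inj ->.
  have R_sym i j : R i j -> R j i.
    by move=> /RP Rij; apply/RP => k; rewrite betC => /Rij ->; rewrite (Rij j).
  have R_tr i j k : R i j -> R j k -> R i k.
    move=> /RP Rij /RP Rjk; apply/RP => l /(betT _ j) /orP[/Rij //|/Rjk ->].
    exact: Rij.
  move=> i j k _ _ _; split=> [|Rij]; first exact: R_refl.
  by apply/idP/idP; [apply/R_tr/R_sym | apply: R_tr].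
have partQ := equivalence_partitionP eqvR.
set Q := equivalence_partition R _ in partQ.
have QP B : B \in Q -> exists i, B = [set j | R i j].
  by case/imsetP => i _ ->; exists i; apply/setP => j; rewrite !inE.
have intQ : interval_partition Q.
  rewrite /interval_partition partQ; apply/forall_inP => B /QP[x ->].
  apply/forall_inP => i; rewrite inE => Rxi; apply/forall_inP => j.
  rewrite inE => Rxj; apply/forallP => k; apply/implyP => ikj; rewrite inE.
  have Rxt u v w : R u v -> R u w = R v w.
    by move=> ?; have [_ ->] := eqvR u v w (in_setT _) (in_setT _) (in_setT _).
  rewrite (Rxt _ _ _ Rxi); apply/RP => l Hl.
  move: Rxj; rewrite (Rxt _ _ _ Rxi) => /RP; apply.
  case/andP: ikj => ik kj; move: Hl; rewrite /between.
  case/orP=> /andP[h1 h2]; first by rewrite h1 (leq_trans h2 kj).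
  have il : i = l :> nat by apply/eqP; rewrite eqn_leq h2 (leq_trans ik h1).
  by rewrite -il leqnn (leq_trans ik kj).
have refQ : refines Q P.
  apply/forall_inP => B /QP[x ->]; apply/exists_inP.
  exists (pblock P x); first by rewrite pblock_mem.
  by apply/subsetP => j; rewrite inE => /RP/(_ _ (betr _ _)) <-; rewrite mem_pblock.
have /negP := negbT (noQ Q); apply; apply/and3P; split=> //.
apply/forallP => Q'; apply/implyP => /andP[/andP[partQ' /forall_inP intQ'] refQ'].
apply/forall_inP => B BQ'; apply/exists_inP.
have /set0Pn[x xB] : B != set0.
  by apply: contraTneq BQ' => ->; have /and3P[] := partQ'.
exists [set j | R x j].
  by apply/imsetP; exists x => //; apply/setP => j; rewrite !inE.
apply/subsetP => y yB; rewrite inE; apply/RP => k Hk.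
have kB : k \in B.
  have intB u v : u \in B -> v \in B -> u <= k <= v -> k \in B.
    move=> uB vB; move: (forall_inP (intQ' _ BQ') u uB) => /forall_inP/(_ v vB).
    by move=> /forallP/(_ k)/implyP.
  by case/orP: Hk; apply: intB.
have /exists_inP[C CP /subsetP BC] := forall_inP refQ' _ BQ'.
by rewrite !(def_pblock trivP CP) ?BC.
Qed.

(* The block of the partition Q that contains the ordinal k. *)
Definition block Q (k : nat) : {set 'I_n} :=
  \bigcup_(B in Q | [exists i in B, i == k :> nat]) B.

Definition M P : nat :=
  maxn 1 (\max_(B in hat P | (B != block (hat P) 0)
                             && (B != block (hat P) n.-1)) #|B|).

(* Truncated subtraction does not change the maximum, because 1 <= M P. *)
Definition Mab (a b : nat) P : nat :=
  maxn (M P) (maxn (#|block (hat P) 0| - a + 1) (#|block (hat P) n.-1| - b + 1)).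

End IntervalPartitions.

(* Main.v *)
Require Import Defs.
From mathcomp Require Import all_boot all_fingroup.
From mathcomp Require Import zify.

(* Let p be in Comp (n + l) G, and let u < w be the entries of p at two adjacent
   positions. Two sets of n positions that differ only by exchanging these two give
   patterns that differ by a cycle (x x+1 ... y) of an interval, so this cycle lies
   in G; the interval varies with the choice of the other n - 1 positions. If
   u + 1 < w, the intervals so obtained overlap and cover a run of points, which is
   therefore contained in one block of the interval partition, and which has more
   than l points unless it is cut off at an end of [n]. As l >= M_{a,b}, the run
   meets the first or the last block, and then, unless u and w both lie among the
   values <= a + 1 or both among the values >= n + l - b, one of the cycles enlarges
   the symmetric group on the first a (or last b) points, against the maximality of
   a and b. Hence no step of the word p jumps over a value in [a + 1, n + l - b]:
   these values form a monotone run of consecutive entries, which separates the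
   smaller values from the larger ones, and so p or its reversal is in S^{a,b}. *)

Set Implicit Arguments.
Unset Strict Implicit.
Unset Printing Implicit Defensive.

(** * Patterns as increasing embeddings, and the group structure of [Comp] *)

Definition increasing n m (f : 'I_n -> 'I_m) : Prop :=
  forall j k : 'I_n, j < k -> f j < f k.

Lemma increasing_lt n m (f : 'I_n -> 'I_m) (j k : 'I_n) :
  increasing f -> (f j < f k) = (j < k).
Proof.
move=> incf; case: (ltngtP j k) => [/incf // | /incf fkj | /val_inj ->].
  by apply/negbTE; rewrite -leqNgt ltnW.
exact: ltnn.
Qed.

Lemma involvesP m n (p : 'S_m) (t : 'S_n) :
  reflect (exists f : 'I_n -> 'I_m, increasing f /\
             forall j k : 'I_n, (p (f j) < p (f k)) = (t j < t k))
          (involves p t).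
Proof.
apply: (iffP existsP) => [[f /forallP ptf] | [f [incf ptf]]].
  exists f; split=> j k; have /forallP/(_ k)/andP[/implyP incf /eqP //] := ptf j.
exists (finfun f); apply/forallP => j; apply/forallP => k; rewrite !ffunE.
by apply/andP; split; [apply/implyP/incf | apply/eqP/ptf].
Qed.

Lemma CompP m n (S : {set 'S_n}) (p : 'S_m) :
  reflect (forall (f : 'I_n -> 'I_m) (t : 'S_n), increasing f ->
             (forall j k : 'I_n, (p (f j) < p (f k)) = (t j < t k)) -> t \in S)
          (p \in Comp m S).
Proof.
rewrite inE; apply: (iffP forallP) => [pS f t incf ptf | pS t].
  by apply: (implyP (pS t)); apply/involvesP; exists f.
by apply/implyP => /involvesP[f [incf ptf]]; apply: pS incf ptf.
Qed.

Lemma card_ltn_ord n (k : nat) : k <= n -> #|[set i : 'I_n | i < k]| = k.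
Proof.
by move=> kn; rewrite -sum1dep_card -(big_ord_widen _ (fun=> 1) kn) sum1_card card_ord.
Qed.

Lemma card_perm_ltn n (r : 'S_n) (y : 'I_n) : #|[set z | r z < r y]| = r y.
Proof.
rewrite -[RHS](card_ltn_ord (ltnW (ltn_ord (r y)))).
rewrite -[LHS](card_imset _ (@perm_inj _ r)); apply: eq_card => x.
rewrite inE; apply/imsetP/idP => [[z] | xy]; first by rewrite inE => ? ->.
by exists (r^-1%g x); rewrite ?inE permKV.
Qed.

(** Counting the points with a smaller image standardises [h] to a permutation. *)
Lemma ranking n m (h : 'I_n -> 'I_m) :
  injective h -> exists r : 'S_n, forall y z, (r y < r z) = (h y < h z).
Proof.
move=> injh; pose below y := [set z | h z < h y].
have below_lt y : #|below y| < n.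
  rewrite -[X in _ < X]card_ord -cardsT; apply/proper_card/properP.
  by split; [exact: subsetT | exists y; rewrite !inE ?ltnn].
have below_mono y z : (#|below y| < #|below z|) = (h y < h z).
  have sub y' z' : h y' <= h z' -> below y' \subset below z'.
    by move=> yz; apply/subsetP => x; rewrite !inE => /leq_trans; apply.
  case: (ltnP (h y) (h z)) => [yz | /sub/subset_leq_card];
    last by rewrite leqNgt => /negbTE.
  apply/proper_card/properP; split; first exact/sub/ltnW.
  by exists y; rewrite !inE ?ltnn.
have injr : injective (fun y => Ordinal (below_lt y)).
  move=> y z /(congr1 val)/= yz; apply/injh/val_inj => /=.
  by case: (ltngtP (h y) (h z)) => //; rewrite -below_mono yz ltnn.
by exists (perm injr) => y z; rewrite !permE /= below_mono.
Qed.

Lemma perm_rank n m (h : 'I_n -> 'I_m) (r : 'S_n) (y : 'I_n) :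
  (forall j k, (h j < h k) = (r j < r k)) -> r y = #|[set z | h z < h y]| :> nat.
Proof. by move=> hr; rewrite -card_perm_ltn; apply: eq_card => z; rewrite !inE hr. Qed.

Lemma increasing_perm1 n m (f : 'I_n -> 'I_m) (t : 'S_n) :
  increasing f -> (forall j k, (f j < f k) = (t j < t k)) -> t = 1%g.
Proof.
move=> incf ft; apply/permP => j; apply/val_inj => /=.
rewrite perm1 (perm_rank _ ft) -[RHS](card_ltn_ord (ltnW (ltn_ord j))).
by apply: eq_card => z; rewrite !inE increasing_lt.
Qed.

Lemma increasing_inj n m (f : 'I_n -> 'I_m) : increasing f -> injective f.
Proof.
move=> incf j k fjk; apply/val_inj => /=.
by case: (ltngtP j k) => // /incf; rewrite fjk ltnn.
Qed.

(** In a finite group closure under products suffices. A pattern [t] of [s * r] is [t1] times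
    [t1^-1 * t], where [t1] is the pattern of [s] at the same positions and [t1^-1 * t] that of [r]
    at the sorted values of [s] there. *)
Lemma Comp_group_set m n (G : {group 'S_n}) : group_set (Comp m G).
Proof.
apply/group_setP; split=> [|s r /CompP sG /CompP rG]; apply/CompP => f t incf ft.
  have -> : t = 1%g; last exact: group1.
  by apply: increasing_perm1 incf _ => j k; rewrite -ft !perm1.
have [t1 t1P] := @ranking _ _ (s \o f) (inj_comp (@perm_inj _ s) (increasing_inj incf)).
rewrite -[t](mulKVg t1) groupM //; first exact: sG incf _.
apply: (rG (fun x => s (f (t1^-1%g x)))) => [x y xy | x y].
  by have := t1P (t1^-1%g x) (t1^-1%g y); rewrite !permKV xy /= => /esym.
by rewrite !permM -ft !permM.
Qed.

Canonical Comp_group m n (G : {group 'S_n}) := Group (@Comp_group_set m n G).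

(** * Cycles in [G] from two adjacent entries, and growth of a symmetric subgroup *)

Definition adjacent m (i j : 'I_m) : Prop := i = j.+1 :> nat \/ j = i.+1 :> nat.

(* c = s^-1 * t, where s and t are patterns of p at two sets of positions that differ
   only by exchanging i1 and i2; p i1 becomes the entry x of s, p i2 the entry y of t. *)
Lemma Comp_cycle m n (G : {group 'S_n}) (p : 'S_m) (i1 i2 : 'I_m) (x y : 'I_n) :
    p \in Comp m G -> adjacent i1 i2 ->
    x <= p i1 -> x <= y -> y + p i1 < p i2 + x -> p i2 + n <= y + m ->
  exists c : 'S_n, [/\ c \in G, c x = y,
    forall z : 'I_n, (z < x) || (y < z) -> c z = z &
    forall z : 'I_n, x < z <= y -> z = (c z).+1 :> nat].
Proof.
move=> /CompP pG adj xu xy gap wy; set u := p i1 in xu gap *; set w := p i2 in gap wy *.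
have [[[ltxn ltyn] ltum] ltwm] := (ltn_ord x, ltn_ord y, ltn_ord u, ltn_ord w).
pose cv (z : nat) :=
  if z < x then z else if z == x :> nat then y : nat else if z <= y then z.-1 else z.
have cv_lt (z : 'I_n) : cv z < n by have := ltn_ord z; rewrite /cv; do !case: ifP; lia.
have injc : injective (fun z => Ordinal (cv_lt z)).
  move=> z z' /(congr1 val) /=; rewrite /cv => zz'; apply/val_inj => /=.
  by move: zz'; do !case: ifP; lia.
pose c : 'S_n := perm injc.
have cE (z : 'I_n) : c z = cv z :> nat by rewrite permE.
(* Increasing list of [n] values: the lowest [x], a run of [y - x + 1] starting at [u], and the
   highest [n - y - 1]. The hypotheses put [w] in the gap above the run, so exchanging [u] for [w]
   moves rank [x] to [y] and lowers the ranks between by one. *)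
pose e1v (z : nat) := if z < x then z else if z <= y then u + (z - x) else z + (m - n).
have nm : n <= m by lia.
have e1_lt (z : 'I_n) : e1v z < m by have := ltn_ord z; rewrite /e1v; do !case: ifP; lia.
pose e1 z := Ordinal (e1_lt z).
have e1_inc : increasing e1 by move=> j k jk; rewrite /= /e1v; do !case: ifP; lia.
have e1x : e1 x = u by apply/val_inj; rewrite /= /e1v; do !case: ifP; lia.
have e1w z : e1 z <> w by move/(congr1 val); rewrite /= /e1v; do !case: ifP; lia.
have injh : injective (fun z => p^-1%g (e1 z)).
  by move=> z z' /perm_inj /(increasing_inj e1_inc).
(* [r] maps the rank of a chosen value to the rank of its position, so [r^-1] is the pattern of [p]
   at the positions [f1]. *)
have [r rP] := ranking injh.
pose f1 j := p^-1%g (e1 (r^-1%g j)).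
have f1_inc : increasing f1 by move=> j k jk; rewrite -rP !permKV.
have t1G : (r^-1)%g \in G.
  by apply: (pG f1) => // j k; rewrite !permKV increasing_lt.
(* As [i2] is next to [i1] and not among the positions [f1], replacing [i1] by [i2] keeps them in
   order. *)
pose f2 j := if r^-1%g j == x then i2 else f1 j.
have f1x j : r^-1%g j = x -> f1 j = i1 by rewrite /f1 => ->; rewrite e1x permK.
have f1N2 j : f1 j <> i2.
  by rewrite /f1 => fj; apply: (e1w (r^-1%g j)); rewrite /w -fj permKV.
have f2_inc : increasing f2.
  move=> j k jk; rewrite /f2.
  have f1N2' z : f1 z <> i2 :> nat by move=> /val_inj /f1N2.
  have := adj; rewrite /adjacent; have := f1_inc _ _ jk; have := f1N2' j; have := f1N2' k.
  case: eqP => [/[dup] rj /f1x ->|_]; case: eqP => [/[dup] rk /f1x ->|_] //; try lia.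
have t2G : (r^-1 * c)%g \in G.
  apply: (pG f2) => // j k; rewrite !permM !cE.
  have pf2 z : p (f2 z) = (if r^-1%g z == x then w : nat else e1v (r^-1%g z)) :> nat.
    by rewrite /f2; case: eqP => // _; rewrite /f1 permKV.
  rewrite !pf2 -!val_eqE /= /e1v /cv; do !case: ifP; lia.
exists c; split.
- by rewrite -(groupMl _ t1G).
- by apply/val_inj; rewrite /= cE /cv ltnn eqxx.
- by move=> z zxy; apply/val_inj; rewrite /= cE /cv; do !case: ifP; lia.
- by move=> z zxy; rewrite cE /cv; do !case: ifP; lia.
Qed.

(** If [s] moves [z], then [s z] and [g z] lie in [X]; following [s] by their transposition and by
    [g^-1] brings [z] back, and an element fixing [z] is supported on [X]. *)
Lemma perm_on_grow (T : finType) (G : {group {perm T}}) (X : {set T}) (z : T)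
    (g : {perm T}) :
    (forall s, perm_on X s -> s \in G) -> g \in G -> perm_on (z |: X) g ->
    g z != z ->
  forall s, perm_on (z |: X) s -> s \in G.
Proof.
move=> XG gG gX gz s sX.
have fixed t : perm_on (z |: X) t -> t z = z -> t \in G.
  move=> tX tz; apply/XG/subsetP => x; rewrite inE => tx.
  have := subsetP tX x; rewrite !inE tx => /(_ isT) /predU1P[xz|//].
  by rewrite xz tz eqxx in tx.
have inX t : perm_on (z |: X) t -> t z != z -> t z \in X.
  by move=> tX tz; have := perm_closed z tX; rewrite !inE eqxx (negbTE tz).
have [/(fixed s sX) // | sz] := eqVneq (s z) z.
have tX : perm_on X (tperm (s z) (g z)).
  by apply: subset_trans (tperm_on _ _) _; apply/subsetP => x /set2P[]->; apply: inX.
rewrite -(groupMr _ (XG _ tX)) -(groupMr _ (groupVr gG)); apply: fixed.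
  rewrite !perm_onM ?perm_onV //.
  exact: subset_trans tX (subsetUr _ _).
by rewrite !permM tpermL permK.
Qed.

Lemma increasing_bounds n m (f : 'I_n -> 'I_m) (j : 'I_n) :
  increasing f -> j <= f j /\ f j + n <= j + m.
Proof.
have lower (g : 'I_n -> 'I_m) : increasing g -> forall k : 'I_n, k <= g k.
  move=> incg [k kn] /=; elim: k kn => // k IHk kn.
  exact: leq_ltn_trans (IHk (ltnW kn)) (incg (Ordinal (ltnW kn)) (Ordinal kn) (ltnSn k)).
move=> incf; split; first exact: lower.
(* The upper bound is the lower bound for [f] conjugated by the reversals. *)
have /lower/(_ (rev_ord j)) : increasing (fun k => rev_ord (f (rev_ord k))).
  move=> k k' kk'; have /incf : rev_ord k' < rev_ord k.
    by have := ltn_ord k'; rewrite /=; lia.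
  by have := ltn_ord (f (rev_ord k)); rewrite /=; lia.
by rewrite rev_ordK /=; have := ltn_ord (f j); have := ltn_ord j; lia.
Qed.

(** * The groups [S^{a,b}] and their patterns *)

Lemma mem_Sab m a b (s : 'S_m) :
    (forall i : 'I_m, i < a -> s i < a) ->
    (forall i : 'I_m, m - b <= i -> m - b <= s i) ->
    (forall i : 'I_m, a <= i < m - b -> s i = i) ->
  s \in Sab m a b.
Proof.
move=> lows highs mids; rewrite inE; apply/and3P; split.
- rewrite eqEcard card_imset ?leqnn ?andbT; last exact: perm_inj.
  by apply/subsetP => _ /imsetP[i + ->]; rewrite !inE => /lows.
- rewrite eqEcard card_imset ?leqnn ?andbT; last exact: perm_inj.
  by apply/subsetP => _ /imsetP[i + ->]; rewrite !inE => /highs.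
- by apply/forallP => i; apply/implyP => /mids ->.
Qed.

Lemma SabP m a b (s : 'S_m) : s \in Sab m a b ->
  [/\ forall i : 'I_m, (s i < a) = (i < a),
      forall i : 'I_m, (m - b <= s i) = (m - b <= i) &
      forall i : 'I_m, a <= i < m - b -> s i = i].
Proof.
rewrite inE => /and3P[/eqP lows /eqP highs /forallP mids]; split=> i.
- by have := mem_imset (low_points m a) i (@perm_inj _ s); rewrite lows !inE.
- by have := mem_imset (high_points m b) i (@perm_inj _ s); rewrite highs !inE.
- by move=> imid; apply/eqP/(implyP (mids i)).
Qed.

Lemma perm_on_low_Sab m a b (s : 'S_m) :
  a + b <= m -> perm_on (low_points m a) s -> s \in Sab m a b.
Proof.
move=> abm sX; apply: mem_Sab => i hi.
- by have := perm_closed i sX; rewrite !inE hi.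
- by rewrite (out_perm sX) // inE; lia.
- by rewrite (out_perm sX) // inE; lia.
Qed.

Lemma perm_on_high_Sab m a b (s : 'S_m) :
  a + b <= m -> perm_on (high_points m b) s -> s \in Sab m a b.
Proof.
move=> abm sX; apply: mem_Sab => i hi.
- by rewrite (out_perm sX) // inE; lia.
- by have := perm_closed i sX; rewrite !inE hi.
- by rewrite (out_perm sX) // inE; lia.
Qed.

(** Dividing [s] by its restriction to the low points leaves a permutation supported on the high
    points. *)
Lemma Sab_sub m a b (G : {group 'S_m}) :
    a + b <= m -> (forall s, perm_on (low_points m a) s -> s \in G) ->
    (forall s, perm_on (high_points m b) s -> s \in G) ->
  Sab m a b \subset G.
Proof.
move=> abm lowG highG; apply/subsetP => s /SabP[lows highs mids].
pose r := restr_perm (low_points m a) s.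
have rlow : perm_on (low_points m a) r by exact: restr_perm_on.
have rE : {in low_points m a, r =1 s}.
  move=> i ilow; apply: restr_permE => //.
  by apply/astabsP => j; rewrite !inE /= /aperm lows.
rewrite -(groupMl _ (groupVr (lowG _ rlow))); apply: highG.
apply/subsetP => i; rewrite !inE permM; apply: contraNT => ihigh.
have [ilow | ilow] := boolP (i \in low_points m a).
  by rewrite -rE ?permKV // perm_closed ?perm_onV.
rewrite (out_perm (perm_onV rlow)) // mids //.
by move: ilow ihigh; rewrite inE; lia.
Qed.

(** A position chosen in the fixed middle keeps its rank, since [s] keeps smaller entries smaller.
    The remaining positions are controlled by [increasing_bounds], where [a + b <= n] prevents low
    ones from being chosen among the high ones and conversely. *)
Lemma Sab_pattern m n a b (s : 'S_m) (t : 'S_n) (f : 'I_n -> 'I_m) :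
    a + b <= n -> s \in Sab m a b -> increasing f ->
    (forall j k, (s (f j) < s (f k)) = (t j < t k)) ->
  t \in Sab n a b.
Proof.
move=> abn /SabP[lows highs mids] incf ft.
have t_bounds j : t j <= s (f j) /\ s (f j) + n <= t j + m.
  have /(@increasing_bounds _ _ _ (t j)) : increasing (fun y => s (f (t^-1%g y))).
    by move=> y z yz; rewrite ft !permKV.
  by rewrite permK.
have t_mid j : a <= f j < m - b -> t j = j.
  move=> fj; apply/val_inj => /=.
  rewrite (perm_rank _ ft) -[RHS](card_ltn_ord (ltnW (ltn_ord j))).
  apply: eq_card => z; rewrite !inE -(increasing_lt z j incf) (mids (f j)) //.
  have := lows (f z); have := highs (f z).
  case: (boolP (a <= f z < m - b)) => [/mids -> //|].
  lia.
apply: mem_Sab => j hj.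
all: have [] := increasing_bounds j incf; have [] := t_bounds j; have := ltn_ord (f j).
all: have := lows (f j); have := highs (f j); have := t_mid j.
- case: (boolP (a <= f j < m - b)) => [_ /(_ isT) -> //|]; lia.
- case: (boolP (a <= f j < m - b)) => [_ /(_ isT) -> //|]; lia.
- by move=> tj *; apply: tj; lia.
Qed.

Lemma Sab_sub_Comp m n a b (G : {group 'S_n}) :
  a + b <= n -> Sab n a b \subset G -> Sab m a b \subset Comp m G.
Proof.
move=> abn /subsetP SG; apply/subsetP => s sS; apply/CompP => f t incf ft.
exact/SG/(Sab_pattern abn sS incf ft).
Qed.

(** * Words without large jumps over the middle values *)

(** The bounds are weak: a jump may end at [a] or start at [m - b - 1], but none passes over a value
    [v] with [a <= v < m - b]. Upward jumps suffice because [adjacent] is symmetric. *)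
Definition small_jumps m a b (p : 'S_m) : Prop :=
  forall i j : 'I_m, adjacent i j -> p i < p j ->
    [\/ p j = (p i).+1 :> nat, p j <= a | m <= p i + b.+1].

(** A discrete intermediate value principle, by induction on the distance from [j] to [k]. *)
Lemma small_jumps_side m a b (p : 'S_m) (v j k : 'I_m) :
    small_jumps a b p -> a <= v < m - b -> j <= k ->
    (forall x : 'I_m, j <= x <= k -> p x != v) ->
  (p j < v) = (p k < v).
Proof.
move=> jumps vmid jk; have [d] := ubnP (k - j); elim: d k jk => // d IHd k jk kd kv.
have [jk'|jk'] := eqVneq (j : nat) k; first by rewrite (val_inj jk').
have k1m : k.-1 < m by have := ltn_ord k; lia.
pose k1 := Ordinal k1m; have k1E : k1 = k.-1 :> nat by [].
have -> : (p j < v) = (p k1 < v).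
  by apply: IHd => [||x jx]; rewrite ?k1E; try lia; apply: kv; move: jx; rewrite k1E; lia.
have k1v : p k1 != v :> nat by rewrite val_eqE; apply: kv; rewrite k1E; lia.
have kkv : p k != v :> nat by rewrite val_eqE; apply: kv; rewrite jk leqnn.
have adj : adjacent k k1 by left; rewrite k1E; lia.
have adj' : adjacent k1 k by right; rewrite k1E; lia.
case: (ltngtP (p k1) (p k)) =>
  [/[dup] lt /(jumps _ _ adj')|/[dup] lt /(jumps _ _ adj)|-> //].
  by case; lia.
by case; lia.
Qed.

(** The position [iv] of [v] splits the word into two parts, each on one side of [v], and the end
    entries decide which. Counting the entries below [v] then gives [iv = v]. *)
Lemma small_jumps_fixed m a b (p : 'S_m) (first last v : 'I_m) :
    small_jumps a b p -> 0 < a -> 0 < b -> first = 0 :> nat -> last.+1 = m ->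
    p first < p last -> a <= v < m - b ->
  p v = v /\ forall j : 'I_m, (p j < v) = (j < v).
Proof.
move=> jumps a0 b0 first0 lastm pfl vmid; pose iv := p^-1%g v.
have ivE : p iv = v by rewrite permKV.
have pv x : x != iv -> p x != v by rewrite -ivE (inj_eq perm_inj).
have before (j : 'I_m) : j < iv -> (p j < v) = (p first < v).
  move=> jiv; apply/esym/(small_jumps_side jumps) => //; first by rewrite first0.
  by move=> x xj; apply/pv; rewrite -val_eqE /=; lia.
have after (j : 'I_m) : iv < j -> (p j < v) = (p last < v).
  move=> jiv; apply/(small_jumps_side jumps) => //; first by have := ltn_ord j; lia.
  by move=> x xj; apply/pv; rewrite -val_eqE /=; lia.
(* The least value occurs before or after [iv]; in the latter case [p last < v], hence again
   [p first < v]. *)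
have first_low : p first < v.
  have xlE := permKV p first; set xl := p^-1%g first in xlE.
  have := before xl; have := after xl; rewrite xlE.
  case: (ltngtP xl iv) => [_ _ /(_ isT) | _ /(_ isT) + _ | /val_inj xliv _ _]; try by lia.
  by move: xlE; rewrite xliv ivE => /(congr1 val) /=; lia.
have last_high : ~~ (p last < v).
  have xhE := permKV p last; set xh := p^-1%g last in xhE.
  have := before xh; have := after xh; rewrite xhE.
  case: (ltngtP xh iv) => [_ _ /(_ isT) | _ /(_ isT) + _ | /val_inj xhiv _ _]; try by lia.
  by move: xhE; rewrite xhiv ivE => /(congr1 val) /=; lia.
have side (j : 'I_m) : (p j < v) = (j < iv).
  case: (ltngtP j iv) => [/before -> // | /after -> | /val_inj ->].
    exact: negbTE.
  by rewrite ivE ltnn.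
have iv_v : iv = v.
  apply/val_inj => /=; rewrite -[LHS](card_ltn_ord (ltnW (ltn_ord iv))) -[in RHS]ivE.
  by rewrite -card_perm_ltn ivE; apply: eq_card => z; rewrite !inE side.
by split=> [|j]; [rewrite -{1}iv_v | rewrite side iv_v].
Qed.

(** As [a + b < m], the middle has end points [a] and [m - b - 1]; both are fixed and separate the
    low and the high points from the middle. *)
Lemma small_jumps_Sab m a b (p : 'S_m) (first last : 'I_m) :
    small_jumps a b p -> 0 < a -> 0 < b -> a + b < m ->
    first = 0 :> nat -> last.+1 = m -> p first < p last ->
  p \in Sab m a b.
Proof.
move=> jumps a0 b0 abm first0 lastm pfl.
have fixed v := small_jumps_fixed (v := v) jumps a0 b0 first0 lastm pfl.
apply: mem_Sab => i hi; last by have [] := fixed i hi.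
  have am : a < m by lia.
  by have [|_ /(_ i) /= ->] := fixed (Ordinal am); rewrite /=; lia.
have cm : (m - b).-1 < m by lia.
have [|cc /(_ i)] := fixed (Ordinal cm); first by rewrite /=; lia.
have : p i <> Ordinal cm by rewrite -{1}cc => /perm_inj ic; move: hi; rewrite ic /=; lia.
by move/eqP; rewrite -val_eqE /=; lia.
Qed.

(** Multiplying by [delta m] on the left reads the word backwards and preserves adjacency, so the
    first entry may be taken smaller than the last. *)
Lemma small_jumps_Sab_delta m a b (p : 'S_m) :
    small_jumps a b p -> 0 < a -> 0 < b -> a + b < m ->
  p \in Sab m a b \/ (delta m * p)%g \in Sab m a b.
Proof.
move=> jumps a0 b0 abm.
have m0 : 0 < m by lia.
have lm : m.-1 < m by lia.
pose first := Ordinal m0; pose last := Ordinal lm.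
have lastm : last.+1 = m by rewrite /=; lia.
case: (ltngtP (p first) (p last)) =>
  [pfl|plf|/val_inj/perm_inj/(congr1 val) /=]; last by lia.
  by left; apply: small_jumps_Sab pfl.
right; apply: (@small_jumps_Sab _ _ _ _ first last) => //.
  move=> i j adj; rewrite !permM; apply: jumps; rewrite /delta !permE.
  by have := ltn_ord i; have := ltn_ord j; move: adj; rewrite /adjacent /=; lia.
rewrite !permM /delta !permE.
have -> : rev_ord first = last by apply/val_inj; rewrite /=; lia.
by have -> : rev_ord last = first by apply/val_inj; rewrite /=; lia.
Qed.

(** * Orbits of [G] and their coarsest interval refinement *)

Lemma orbits_partition n (G : {group 'S_n}) : partition (orbits_of G) [set: 'I_n].
Proof. by apply: orbit_partition; apply/actsP => c _ x; rewrite !inE. Qed.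

Lemma is_intervalP n (B : {set 'I_n}) :
  reflect (forall x y z : 'I_n, x \in B -> y \in B -> x <= z <= y -> z \in B)
          (is_interval B).
Proof.
apply: (iffP forall_inP) => [Bint x y z xB yB | Bint x xB].
  by move: (forall_inP (Bint x xB) y yB) => /forallP/(_ z)/implyP.
by apply/forall_inP => y yB; apply/forallP => z; apply/implyP; apply: Bint.
Qed.

Section HatOrbits.

Variables (n : nat) (G : {group 'S_n}).
Let Q := hat (orbits_of G).

Lemma hat_orbits_partition : partition Q [set: 'I_n].
Proof. by have /and3P[/andP[]] := hatP (orbits_partition G). Qed.

Lemma hat_orbits_interval B : B \in Q -> is_interval B.
Proof.
by move=> BQ; have /and3P[/andP[_ /forall_inP/(_ B BQ)]] := hatP (orbits_partition G).
Qed.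

Lemma hat_orbits_orbit B x y :
  B \in Q -> x \in B -> y \in B -> y \in orbit 'P G x.
Proof.
move=> BQ xB yB; have /and3P[_ /forall_inP/(_ B BQ)/exists_inP[C + /subsetP BC] _] :=
  hatP (orbits_partition G).
case/imsetP=> z _ Cz; have := BC x xB; have := BC y yB; rewrite Cz.
by move=> yz xz; rewrite (orbit_eqP xz).
Qed.

Lemma block_hat_orbits B (x : 'I_n) : B \in Q -> x \in B -> B = block Q x.
Proof.
move=> BQ xB; have /and3P[_ /trivIsetP trivQ _] := hat_orbits_partition.
apply/eqP; rewrite eqEsubset; apply/andP; split.
  by apply: bigcup_sup; rewrite BQ; apply/exists_inP; exists x.
apply/bigcupsP => C /andP[CQ /exists_inP[y yC /eqP/val_inj yx]].
rewrite yx in yC.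
have [-> // | CB] := eqVneq C B.
by have /disjoint_setI0/setP/(_ x) := trivQ _ _ CQ BQ CB; rewrite !inE xB yC.
Qed.

(* Test the coarsest refinement against R together with singletons. *)
Lemma sub_hat_orbits (R : {set 'I_n}) (x0 : 'I_n) :
    x0 \in R -> is_interval R -> (forall x, x \in R -> x \in orbit 'P G x0) ->
  exists2 B, B \in Q & R \subset B.
Proof.
move=> x0R /is_intervalP Rint Rorb.
pose f x := if x \in R then None else Some x.
have partQ' := preim_partitionP f [set: 'I_n]; set Q' := preim_partition f _ in partQ'.
have blockQ' C : C \in Q' -> C = R \/ exists x, C = [set x].
  case/imsetP => x _ ->; case: (boolP (x \in R)) => xR.
    by left; apply/setP => y; rewrite !inE /f xR; case: (y \in R).
  right; exists x; apply/setP => y; rewrite !inE /f (negbTE xR).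
  case: ifP => yR; last by rewrite eq_sym.
  by apply/esym/negbTE; apply: contraNneq xR => <-.
have intQ' : interval_partition Q'.
  rewrite /interval_partition partQ'; apply/forall_inP => C /blockQ'[-> | [x ->]].
    exact/is_intervalP.
  by apply/is_intervalP => y z t; rewrite !inE -!val_eqE /=; lia.
have refQ' : refines Q' (orbits_of G).
  apply/forall_inP => C /blockQ'[-> | [x ->]]; apply/exists_inP.
    by exists (orbit 'P G x0); [exact: imset_f | apply/subsetP].
  by exists (orbit 'P G x); [exact: imset_f | rewrite sub1set orbit_refl].
have RQ' : R \in Q'.
  apply/imsetP; exists x0 => //; apply/setP => y.
  by rewrite !inE /f x0R; case: (y \in R).
have /and3P[_ _ /forallP/(_ Q')] := hatP (orbits_partition G).
by rewrite intQ' refQ' /= => /forall_inP/(_ R RQ')/exists_inP.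
Qed.

End HatOrbits.

Lemma intransitive_orbit n (G : {group 'S_n}) (x : 'I_n) :
  intransitive G -> exists y, y \notin orbit 'P G x.
Proof.
move=> intrG; apply/existsP; rewrite -negb_forall; apply: contraNN intrG => /forallP allx.
by apply/imsetP; exists x => //; apply/setP => y; rewrite allx inE.
Qed.

(** * Lower bounds on the sizes of intervals *)

Lemma card_interval_low n (B : {set 'I_n}) (x y : 'I_n) :
  is_interval B -> x = 0 :> nat -> x \in B -> y \in B -> y < #|B|.
Proof.
move=> /is_intervalP Bint x0 xB yB; rewrite -(card_ltn_ord (ltn_ord y)).
by apply/subset_leq_card/subsetP => z; rewrite inE => zy; apply: Bint xB yB _; rewrite x0.
Qed.

Lemma card_interval_high n (B : {set 'I_n}) (x y : 'I_n) :
  is_interval B -> x.+1 = n -> x \in B -> y \in B -> n - y <= #|B|.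
Proof.
move=> /is_intervalP Bint xn xB yB.
have -> : n - y = #|[set z : 'I_n | y <= z]|.
  have := cardsC [set z : 'I_n | z < y].
  rewrite card_ord (card_ltn_ord (ltnW (ltn_ord y))).
  have -> : ~: [set z : 'I_n | z < y] = [set z : 'I_n | y <= z].
    by apply/setP => z; rewrite !inE -leqNgt.
  lia.
apply/subset_leq_card/subsetP => z; rewrite inE => yz; apply: Bint yB xB _.
by have := ltn_ord z; lia.
Qed.

Lemma card_interval n (R : {set 'I_n}) (lo hi : nat) :
  hi < n -> (forall x : 'I_n, (x \in R) = (lo <= x <= hi)) -> hi.+1 - lo <= #|R|.
Proof.
move=> hin RE.
have -> : R = [set z : 'I_n | z < hi.+1] :\: [set z : 'I_n | z < lo].
  by apply/setP => z; rewrite RE !inE ltnS -leqNgt.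
case: (leqP lo hi) => [lohi | hilo]; last by rewrite (eqP hilo).
rewrite cardsD (card_ltn_ord hin) leq_sub2l //.
rewrite -[X in _ <= X](@card_ltn_ord n); last by lia.
exact/subset_leq_card/subsetIr.
Qed.

(** * What a jump in an element of [Comp] forces on [G] *)

Lemma Comp_step n l (G : {group 'S_n}) (p : 'S_(n + l)) (i j : 'I_(n + l)) (x : 'I_n) :
    p \in Comp (n + l) G -> adjacent i j -> (p i).+1 < p j -> 0 < l ->
    (p i).+1 - l < x < p j ->
  exists2 c, c \in G & x = (c x).+1 :> nat.
Proof.
move=> pG adj gap l0 xij; have [ltxn ltj] := (ltn_ord x, ltn_ord (p j)).
(* [Comp_cycle] asks for a left end at most [p i] and a right end at least [p j - l]; this is the
   shortest such interval containing [x - 1] and [x]. *)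
have yn : minn (p i) x.-1 < n by lia.
have zn : maxn x (p j - l) < n by lia.
have [||||c [cG _ _ cE]] := @Comp_cycle _ _ G p i j (Ordinal yn) (Ordinal zn) pG adj;
  rewrite /=; try lia.
by exists c => //; apply: cE; rewrite /=; lia.
Qed.

(** The cycle on the interval from [min(p i, a - 1)] to [a] sends [a] to [a - 1], which joins [a] to
    the low points. *)
Lemma Comp_low_grow n l a (G : {group 'S_n}) (p : 'S_(n + l)) (i j : 'I_(n + l)) :
    p \in Comp (n + l) G -> adjacent i j -> (p i).+1 < p j <= a + l -> a < p j ->
    0 < a -> a < n -> (forall s, perm_on (low_points n a) s -> s \in G) ->
  forall s, perm_on (low_points n a.+1) s -> s \in G.
Proof.
move=> pG adj gap aj a0 an lowG.
have xn : minn (p i) a.-1 < n by lia.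
have [||||c [cG _ c_id cE]] := @Comp_cycle _ _ G p i j (Ordinal xn) (Ordinal an) pG adj;
  rewrite /=; try lia.
have -> : low_points n a.+1 = Ordinal an |: low_points n a.
  by apply/setP => z; rewrite !inE -val_eqE /=; lia.
apply: (perm_on_grow lowG cG).
  apply/subsetP => z; rewrite inE; apply: contraNT => zX; apply/eqP/c_id.
  by move: zX; rewrite !inE -val_eqE /=; lia.
have ca : Ordinal an = (c (Ordinal an)).+1 :> nat by apply: cE; rewrite /=; lia.
by apply/eqP => /(congr1 val); move: ca => /=; lia.
Qed.

(** The cycle on the interval from [n - b - 1] to [max(p j - l, n - b)] sends its least point to its
    greatest, which joins [n - b - 1] to the high points. *)
Lemma Comp_high_grow n l b (G : {group 'S_n}) (p : 'S_(n + l)) (i j : 'I_(n + l)) :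
    p \in Comp (n + l) G -> adjacent i j -> (p i).+1 < p j -> n <= p i + b.+1 < n + l ->
    0 < b -> b < n -> (forall s, perm_on (high_points n b) s -> s \in G) ->
  forall s, perm_on (high_points n b.+1) s -> s \in G.
Proof.
move=> pG adj gap ib b0 bn highG; have ltj := ltn_ord (p j).
have xn : n - b.+1 < n by lia.
have yn : maxn (p j - l) (n - b) < n by lia.
have [||||c [cG cx c_id _]] := @Comp_cycle _ _ G p i j (Ordinal xn) (Ordinal yn) pG adj;
  rewrite /=; try lia.
have -> : high_points n b.+1 = Ordinal xn |: high_points n b.
  by apply/setP => z; rewrite !inE -val_eqE /=; lia.
apply: (perm_on_grow highG cG).
  apply/subsetP => z; rewrite inE; apply: contraNT => zX; apply/eqP/c_id.
  by move: zX; rewrite !inE -val_eqE /=; lia.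
by rewrite cx -val_eqE /=; lia.
Qed.

Lemma Comp_small_jumps n l a b (G : {group 'S_n}) (p : 'S_(n + l)) :
    intransitive G -> 0 < a -> 0 < b -> a < n -> b < n ->
    (forall s, perm_on (low_points n a) s -> s \in G) ->
    (forall s, perm_on (high_points n b) s -> s \in G) ->
    (a.+1 < n -> ~ forall s, perm_on (low_points n a.+1) s -> s \in G) ->
    (b.+1 < n -> ~ forall s, perm_on (high_points n b.+1) s -> s \in G) ->
    Mab a b (orbits_of G) <= l -> p \in Comp (n + l) G ->
  small_jumps a b p.
Proof.
move=> intrG a0 b0 an bn lowG highG lowmax highmax Ml pG i j adj ij.
have [eij | jump] := eqVneq (p j : nat) (p i).+1; first by constructor 1.
have [pja | apj] := leqP (p j) a; first by constructor 2.
have [pib | pib] := leqP (n + l) (p i + b.+1); first by constructor 3.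
exfalso; have gap : (p i).+1 < p j by lia.
move: Ml; rewrite /Mab /M !geq_max -andbA => /and4P[l0 midl lowl highl].
have ltj := ltn_ord (p j).
(* By [Comp_step] each point above [lo] and up to [hi] shares the orbit of its predecessor.
   Truncation and minimum cut the run at the ends of [[n]]; uncut, it has [p j - p i - 1 + l > l]
   points. *)
pose lo := (p i).+1 - l; pose hi := minn (p j).-1 n.-1.
have hin : hi < n by lia.
have lon : lo < n by lia.
have lohi : lo <= hi by lia.
pose R := [set x : 'I_n | lo <= x <= hi].
have RE x : (x \in R) = (lo <= x <= hi) by rewrite inE.
pose x0 := Ordinal lon; have x0R : x0 \in R by rewrite RE /= leqnn.
pose x1 := Ordinal hin; have x1R : x1 \in R by rewrite RE /= leqnn andbT.
have Rint : is_interval R by apply/is_intervalP => x y z; rewrite !RE; lia.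
have Rorb x : x \in R -> x \in orbit 'P G x0.
  case: x => k; elim: k => [|k IHk] kn; rewrite RE /= => /andP[lok khi].
    by rewrite (_ : Ordinal kn = x0) ?orbit_refl //; apply/val_inj; rewrite /=; lia.
  have [lok' | klo] := leqP lo k; last first.
    by rewrite (_ : Ordinal kn = x0) ?orbit_refl //; apply/val_inj; rewrite /=; lia.
  have [|c cG] := @Comp_step _ _ G p i j (Ordinal kn) pG adj gap l0;
    first by rewrite /=; lia.
  move=> [/= ck]; have := IHk (ltnW kn); rewrite RE /=.
  move=> /(_ _)/orbit_eqP <-; last by lia.
  rewrite orbit_sym; apply/orbitP; exists c => //=; rewrite /aperm.
  by apply/val_inj; rewrite /= -ck.
have [B BQ /subsetP RB] := sub_hat_orbits x0R Rint Rorb.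
have Bint := hat_orbits_interval BQ.
have first0 : 0 < n by lia.
have lastn : n.-1 < n by lia.
pose first := Ordinal first0; pose last := Ordinal lastn.
(* A block containing both ends would be all of [[n]] inside one orbit. *)
have not_both : first \in B -> last \in B -> False.
  move=> fB lB; have [y /negP[]] := intransitive_orbit first intrG.
  apply: (hat_orbits_orbit BQ) => //; apply: (is_intervalP _ Bint) fB lB _.
  by have := ltn_ord y; rewrite /=; lia.
have [fB | fB] := boolP (first \in B).
  have lB : last \notin B by apply/negP; apply: not_both fB.
  have hi_last : hi != n.-1.
    by apply: contraNneq lB => hil; rewrite (_ : last = x1) ?RB //; apply/val_inj.
  have := card_interval_low Bint (erefl : first = 0 :> nat) fB (RB _ x1R).
  move: lowl; rewrite (block_hat_orbits BQ fB) -/first /= => lowl hiB.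
  (* Here [hi] is [p j - 1], so [a < p j < n], and [p j <= #|B| < a + l] is the bound for
     [Comp_low_grow]. *)
  have a1n : a.+1 < n by lia.
  apply: (lowmax a1n); apply: (Comp_low_grow pG adj _ apj a0 an lowG); lia.
have [lB | lB] := boolP (last \in B).
  have lo_first : lo != 0.
    by apply: contraNneq fB => lof; rewrite (_ : first = x0) ?RB //; apply/val_inj.
  have := card_interval_high Bint (prednK first0 : last.+1 = n) lB (RB _ x0R).
  move: highl; rewrite (block_hat_orbits BQ lB) /= => highl loB.
  (* Here [lo] is [p i + 1 - l > 0], so [pib] gives [b + 1 < n], and [n - lo <= #|B| < b + l] gives
     [n < p i + b + 1]. *)
  have b1n : b.+1 < n by lia.
  apply: (highmax b1n); apply: (Comp_high_grow pG adj gap _ b0 bn highG); lia.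
have lo_first : lo != 0.
  by apply: contraNneq fB => lof; rewrite (_ : first = x0) ?RB //; apply/val_inj.
have hi_last : hi != n.-1.
  by apply: contraNneq lB => hil; rewrite (_ : last = x1) ?RB //; apply/val_inj.
have notin_block x : x \notin B -> B != block (hat (orbits_of G)) x.
  move=> xB; apply: contraNneq xB => Bx.
  have /and3P[/eqP covQ _ _] := hat_orbits_partition G.
  have : x \in cover (hat (orbits_of G)) by rewrite covQ inE.
  by case/bigcupP=> C CQ xC; rewrite Bx -(block_hat_orbits CQ xC).
have BM : #|B| <= l.
  apply: leq_trans midl; apply: (bigmax_sup B) => //.
  by rewrite BQ (notin_block first fB) (notin_block last lB).
have := card_interval hin RE; have := subset_leq_card (introT subsetP RB).
lia.
Qed.

(** * The two cases: without and with the reversal *)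

Lemma delta_invol m : (delta m * delta m)%g = 1%g.
Proof. by apply/permP => i; rewrite permM !permE rev_ordK. Qed.

Theorem theorem4p11 (n : nat) (G : {group 'S_n}) (a b : nat)
    (intrG : intransitive G)
    (a_largest : is_largest (fun alpha => exists beta, admissible G alpha beta) a)
    (b_largest : is_largest (fun beta => exists alpha, admissible G alpha beta) b)
    (l : nat) (lM : Mab a b (orbits_of G) <= l) :
  Comp (n + l) G = Sab (n + l) a b
  \/ Comp (n + l) G = <<Sab (n + l) a b :|: [set delta (n + l)]>>%g.
Proof.
have [[b' [a0 b'0 ab'n /subsetP Sab'G]] amax] := a_largest.
have [[a' [a'0 b0 a'bn /subsetP Sa'bG]] bmax] := b_largest.
have lowG s : perm_on (low_points n a) s -> s \in G.
  by move=> sX; apply/Sab'G/perm_on_low_Sab.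
have highG s : perm_on (high_points n b) s -> s \in G.
  by move=> sX; apply/Sa'bG/perm_on_high_Sab.
have an : a < n by lia.
have bn : b < n by lia.
(* A single high point carries only the identity, so [a + 1] would be admissible with partner
   [1]. *)
have lowmax : a.+1 < n -> ~ forall s, perm_on (low_points n a.+1) s -> s \in G.
  move=> a1n low1G; have := amax a.+1; rewrite ltnn => /(_ _)/notF; apply.
  exists 1; split; rewrite ?addn1 //; apply: Sab_sub => //; first by rewrite addn1.
  move=> s sX; rewrite (perm_on_id sX) ?group1 //.
  apply/card_le1_eqP => x y; rewrite !inE => ? ?; apply/val_inj => /=.
  by have := ltn_ord x; have := ltn_ord y; lia.
have highmax : b.+1 < n -> ~ forall s, perm_on (high_points n b.+1) s -> s \in G.
  move=> b1n high1G; have := bmax b.+1; rewrite ltnn => /(_ _)/notF; apply.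
  exists 1; split; rewrite ?add1n //; apply: Sab_sub => //.
  move=> s sX; rewrite (perm_on_id sX) ?group1 //.
  apply/card_le1_eqP => x y; rewrite !inE => ? ?; apply/val_inj => /=.
  by lia.
(* The two maxima may have different partners. If the low and high points overlapped, [a - 1] would
   lie in both sets and link [0] to every point, making [G] transitive. *)
have abn : a + b <= n.
  rewrite leqNgt; apply/negP => nab; have n0 : 0 < n by lia.
  have a1n : a.-1 < n by lia.
  pose x0 := Ordinal n0; pose x1 := Ordinal a1n.
  have tlow (x y : 'I_n) : x < a -> y < a -> tperm x y \in G.
    move=> xa ya; apply/lowG/(subset_trans (tperm_on x y)).
    by apply/subsetP => z /set2P[]->; rewrite inE.
  have thigh (x y : 'I_n) : n - b <= x -> n - b <= y -> tperm x y \in G.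
    move=> xb yb; apply/highG/(subset_trans (tperm_on x y)).
    by apply/subsetP => z /set2P[]->; rewrite inE.
  have [y /negP[]] := intransitive_orbit x0 intrG.
  have [ya | ay] := ltnP y a.
    by apply/orbitP; exists (tperm x0 y); [apply: tlow | rewrite /= /aperm tpermL].
  apply/orbitP; exists (tperm x0 x1 * tperm x1 y)%g.
    by apply: groupM; [apply: tlow | apply: thigh]; rewrite /=; lia.
  by rewrite /= /aperm permM !tpermL.
have l0 : 0 < l by move: lM; rewrite /Mab /M !geq_max -!andbA => /andP[].
have SC : Sab (n + l) a b \subset Comp (n + l) G.
  exact/Sab_sub_Comp/Sab_sub.
have jumps p (pC : p \in Comp (n + l) G) :
    p \in Sab (n + l) a b \/ (delta (n + l) * p)%g \in Sab (n + l) a b.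
  apply: small_jumps_Sab_delta => //; last by lia.
  exact: Comp_small_jumps lowmax highmax lM pC.
have [CS | /subsetPn[p pC pS]] := boolP (Comp (n + l) G \subset Sab (n + l) a b).
  by left; apply/eqP; rewrite eqEsubset CS.
(* Both [p] and [delta * p] lie in the group [Comp], hence so does [delta]. *)
have dC : delta (n + l) \in Comp (n + l) G.
  have [|dp] := jumps p pC; first by rewrite (negbTE pS).
  have := subsetP SC _ dp.
  by rewrite (groupMr (G := Comp_group (n + l) G) _ pC).
right; apply/eqP; rewrite eqEsubset; apply/andP; split; last first.
  by rewrite (gen_subG _ (Comp_group (n + l) G)) subUset SC sub1set.
apply/subsetP => q /jumps[qS | dqS]; first by apply/mem_gen; rewrite inE qS.
rewrite -[q]mul1g -(delta_invol (n + l)) -mulgA.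
by rewrite groupM // mem_gen // inE ?dqS ?set11 ?orbT.
Qed.
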